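(* Let $A$ be a self-adjoint nonnegative linear operator with dense domain on a separable real Hilbert space $H$. Let $c:[0,+\infty)\to\mathbb{R}$ satisfy $0<\mu_1\le c(t)\le\mu_2$ for every $t\ge0$, and $$|c(a)-c(b)|\le\omega(|a-b|)\qquad\forall a\ge0,\ \forall b\ge 0,$$ for some continuity modulus $\omega$. Let $\sigma\in[0,1/2]$ and $\delta>0$ be real numbers such that $$4\delta^{2}\mu_1>\Lambda_\infty^{2}+2\delta\Lambda_\infty,\qquad\text{where}\qquad\Lambda_\infty:=\limsup_{\varepsilon\to0^{+}}\frac{\omega(\varepsilon)}{\varepsilon^{1-2\sigma}}.$$ Let $(u_0,u_1)\in D(A^{1/2})\times H$, and let $u$ be the unique solution of the problem $$u''(t)+2\delta A^{\sigma}u'(t)+c(t)Au(t)=0,\qquad u(0)=u_0,\quad u'(0)=u_1.$$ Then $$u\in C^{0}\left([0,+\infty),D(A^{1/2})\right)\cap C^{1}\left([0,+\infty),H\right).$$ Moreover, for every $\nu\ge1$ such that $$4\delta^{2}\mu_1\ge\left[\lambda^{1-2\sigma}\omega\left(\frac1\lambda\right)\right]^{2}+2\delta\left[\lambda^{1-2\sigma}\omega\left(\frac1\lambda\right)\right]\qquad\text{for every }\lambda\ge\nu,$$ it turns out that, for every $t\ge0$, $$|u_{\nu,+}'(t)|^{2}+2\mu_1|A^{1/2}u_{\nu,+}(t)|^{2}\le4|u_{1,\nu,+}|^{2}+2(3\delta^{2}+\mu_2)|A^{1/2}u_{0,\nu,+}|^{2}.$$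
   Context: Continuity modulus: a continuous function $\omega:[0,+\infty)\to[0,+\infty)$ such that $\omega(0)=0$, $\omega(x)>0$ for every $x>0$, $x\mapsto\omega(x)$ is nondecreasing, and $x\mapsto x/\omega(x)$ is nondecreasing (on $x>0$). Spectral representation. By the spectral theorem, $H$ is identified with $L^2(M,\mu)$ for a suitable measure space $(M,\mu)$, in such a way that $A$ becomes multiplication by $\lambda^2(\xi)$, where $\lambda:M\to[0,+\infty)$ is measurable. The element of $L^2(M,\mu)$ corresponding to $u$ is denoted by $\widehat u(\xi)$. (If $H$ has an orthonormal basis $\{e_k\}$ with $Ae_k=\lambda_k^2e_k$, then $M=\mathbb{N}$ with counting measure, $\lambda(k)=\lambda_k$, and $\widehat u(k)=u_k=\langle u,e_k\rangle$.) For $\alpha\ge0$, $u\in D(A^{\alpha})$ means $\|u\|_{D(A^\alpha)}^2:=\int_M(1+\lambda(\xi))^{4\alpha}|\widehat u(\xi)|^2\,d\mu<+\infty$; $|\cdot|$ is the norm of $H$. Frequency decomposition. For $\nu\ge0$ and a vector $u$, $u_{\nu,+}$ is the vector with $\widehat{u_{\nu,+}}=\widehat u$ on $\{\lambda\ge\nu\}$ and $0$ elsewhere; $u_{\nu,-}:=u-u_{\nu,+}$. We write $u_{\nu,+}(t)$, $u_{\nu,+}'(t)$, $u_{0,\nu,+}$, $u_{1,\nu,+}$ for the corresponding components of $u(t)$, $u'(t)$, $u_0$, $u_1$. Solution. The unique solution $u$ is characterized componentwise: for a.e. $\xi\in M$, with $\lambda=\lambda(\xi)$, the function $t\mapsto\widehat{u(t)}(\xi)=:y(t)$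 solves $y''+2\delta\lambda^{2\sigma}y'+\lambda^2c(t)y=0$ on $[0,+\infty)$ with $y(0)=\widehat{u_0}(\xi)$, $y'(0)=\widehat{u_1}(\xi)$; moreover $\widehat{u'(t)}(\xi)=y'(t)$. (It is known that this is the unique solution, a priori with values in a large space of ultradistributions.) *)

(* Defs.v *)
From HB Require Import structures.
From mathcomp Require Import all_boot all_order all_algebra.
From mathcomp Require Import all_classical all_reals all_analysis.

Set Implicit Arguments.
Unset Strict Implicit.
Unset Printing Implicit Defensive.

Import Order.TTheory GRing.Theory Num.Theory.
Import numFieldNormedType.Exports.

Local Open Scope classical_set_scope.
Local Open Scope ring_scope.

Definition continuity_modulus (R : realType) (omega : R -> R) : Prop :=
  [/\ {within `[0, +oo[, continuous omega},
      omega 0 = 0,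
      forall x : R, 0 < x -> 0 < omega x,
      forall x y : R, 0 <= x -> x <= y -> omega x <= omega y &
      forall x y : R, 0 < x -> x <= y -> x / omega x <= y / omega y].

(* The value may be +oo. *)
Definition Lambda_infty (R : realType) (omega : R -> R) (sigma : R) : \bar R :=
  limf_esup (fun e : R => (omega e / e `^ (1 - 2 * sigma))%:E) 0^'+.

(* f' is the derivative of f on [0, +oo[, one-sided at 0. *)
Definition derivative_on_halfline (R : realType) (V : normedModType R)
    (f f' : R -> V) : Prop :=
  forall t : R, 0 <= t ->
    (fun s : R => (s - t)^-1 *: (f s - f t)) @ within `[0, +oo[ t^' --> f' t.

Section Hilbert.
Context (R : realType) (H : completeNormedModType R).

(* Together with the completeness of H, this makes H a real Hilbert space. *)
Definition inner_product_of_norm (ip : {dot H for idfun}) : Prop :=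
  forall x : H, `|x| ^+ 2 = ip x x.

Definition separable_space : Prop :=
  exists2 S : set H, countable S & dense S.

(* An unbounded operator is given by its domain and by a total function whose
   values outside the domain are irrelevant. *)
Definition densely_defined_linear (D : set H) (A : H -> H) : Prop :=
  [/\ dense D, D 0 &
      forall (a : R) x y, D x -> D y ->
        D (a *: x + y) /\ A (a *: x + y) = a *: A x + A y].

(* The last clause says that the domain of the adjoint is contained in D. *)
Definition self_adjoint (ip : {dot H for idfun}) (D : set H) (A : H -> H) :
    Prop :=
  [/\ densely_defined_linear D A,
      forall x y, D x -> D y -> ip (A x) y = ip x (A y) &
      forall y, (exists z, forall x, D x -> ip (A x) y = ip x z) -> D y].

Definition nonnegative_operator (ip : {dot H for idfun}) (D : set H)
    (A : H -> H) : Prop :=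
  forall x, D x -> 0 <= ip (A x) x.

End Hilbert.

Section Spectral.
Context (R : realType) (H : completeNormedModType R).
Context (d : measure_display) (M : measurableType d).
Context (mu : {measure set M -> \bar R}).
Context (lam : M -> R) (hat : H -> {mfun M >-> R}).

(* hat x is a representative of the class in L^2(M, mu) identified with x. *)
Record spectral_representation (D : set H) (A : H -> H) : Prop := {
  spec_lam_measurable : measurable_fun setT lam;
  spec_lam_ge0 : forall xi, 0 <= lam xi;
  spec_hat_L2 : forall x, (hat x : M -> R) \in Lfun mu 2%:E;
  spec_hat_linear : forall (a : R) x y,
    {ae mu, forall xi, hat (a *: x + y) xi = a * hat x xi + hat y xi};
  spec_hat_isometry : forall x,
    (`|x| ^+ 2)%:E = (\int[mu]_xi (hat x xi ^+ 2)%:E)%E;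
  spec_hat_surjective : forall f : M -> R, f \in Lfun mu 2%:E ->
    exists x, {ae mu, forall xi, hat x xi = f xi};
  spec_domain : forall x,
    D x <-> (fun xi => lam xi ^+ 2 * hat x xi) \in Lfun mu 2%:E;
  spec_operator : forall x, D x ->
    {ae mu, forall xi, hat (A x) xi = lam xi ^+ 2 * hat x xi} }.

(* The square of the norm of D(A^alpha), possibly +oo. *)
Definition Dnorm2 (alpha : R) (x : H) : \bar R :=
  (\int[mu]_xi ((1 + lam xi) `^ (4 * alpha) * `|hat x xi| ^+ 2)%:E)%E.

Definition Dpow (alpha : R) : set H := [set x | (Dnorm2 alpha x < +oo)%E].

Definition Dnorm (alpha : R) (x : H) : R := Num.sqrt (fine (Dnorm2 alpha x)).

(* The vector of H whose image in L^2(M, mu) is m * hat x; it is 0 by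
   convention if there is none. *)
Definition spectral_multiplier (m : M -> R) (x : H) : H :=
  xget 0 [set y | {ae mu, forall xi, hat y xi = m xi * hat x xi}].

Definition Apow (alpha : R) : H -> H :=
  spectral_multiplier (fun xi => lam xi `^ (2 * alpha)).

(* The component x_{nu,+}. *)
Definition high (nu : R) : H -> H :=
  spectral_multiplier \1_[set xi | nu <= lam xi].

Definition ode_solution (delta sigma : R) (c : R -> R) (l : R)
    (y y' : R -> R) (y0 y1 : R) : Prop :=
  exists y'' : R -> R,
    [/\ derivative_on_halfline (y : R -> R^o) y',
        derivative_on_halfline (y' : R -> R^o) y'',
        forall t : R, 0 <= t ->
          y'' t + 2 * delta * l `^ (2 * sigma) * y' t
            + l ^+ 2 * c t * y t = 0,
        y 0 = y0 & y' 0 = y1].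

(* A generalized vector (an ultradistribution) is a measurable function on M,
   with no integrability required: uhat t and uhat' t are the components of
   u(t) and u'(t), which are not assumed to belong to H. *)
Definition componentwise_solution (delta sigma : R) (c : R -> R) (u0 u1 : H)
    (uhat uhat' : R -> {mfun M >-> R}) : Prop :=
  {ae mu, forall xi,
    ode_solution delta sigma c (lam xi)
      (fun t => uhat t xi) (fun t => uhat' t xi) (hat u0 xi) (hat u1 xi)}.

(* The generalized vectors w t, for t >= 0, are the vectors u t of H. *)
Definition represents (u : R -> H) (w : R -> {mfun M >-> R}) : Prop :=
  forall t : R, 0 <= t -> {ae mu, forall xi, hat (u t) xi = w t xi}.

Definition C0_Dpow (alpha : R) (u : R -> H) : Prop :=
  forall t : R, 0 <= t -> Dpow alpha (u t) /\
    (fun s : R => Dnorm alpha (u s - u t)) @ within `[0, +oo[ (nbhs t) --> 0.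

End Spectral.

Definition C1_with_derivative (R : realType) (V : normedModType R)
    (u u' : R -> V) : Prop :=
  derivative_on_halfline u u' /\ {within `[0, +oo[, continuous u'}.

(* Main.v *)
(* Each spectral component solves [y'' + 2 delta l^(2 sigma) y' + l^2 c y = 0].
   Replace [c] by its average [ce] over [[t, t + 1 / l]], which is differentiable,
   and put [a = delta l^(2 sigma)].  The energy
   [(y' + a y)^2 + (l^2 ce + a^2) y^2] has a derivative which is a quadratic form
   in [y] and [y']; the condition relating [mu1], [delta] and
   [l^(1 - 2 sigma) omega(1 / l)] says exactly that its discriminant is
   nonpositive.  Hence the energy decreases at high frequencies, which gives the
   estimate; the condition on the limsup makes this apply to all large [l], and
   at the remaining bounded frequencies a Gronwall argument suffices.  The
   components are thus dominated, locally uniformly in time, by a fixed integrable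
   function of the data, and continuity and differentiability of the vectors follow
   from those of the components by dominated convergence. *)

Require Import Defs.
From HB Require Import structures.
From mathcomp Require Import all_boot all_order all_algebra.
From mathcomp Require Import all_classical all_reals all_analysis.
From mathcomp Require Import measurable_realfun ring lra.

Set Implicit Arguments.
Unset Strict Implicit.
Unset Printing Implicit Defensive.

Import Order.TTheory GRing.Theory Num.Theory.
Import numFieldNormedType.Exports.

Local Open Scope classical_set_scope.
Local Open Scope ring_scope.

(** * Derivatives on the half-line *)

Section HalflineDerivative.
Context {R : realType}.
Implicit Types (f g : R -> R) (t : R).

Notation halfline := (`[0, +oo[%classic : set R).

Lemma derivative_on_halfline_cvg (V : normedModType R) (f f' : R -> V) t :
  derivative_on_halfline f f' -> 0 <= t ->
  f @ within halfline (nbhs t) --> f t.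
Proof.
move=> df t0; apply/cvgrPdist_lt => e e0.
move: (df t t0) => /cvgrPdist_lt /(_ 1 ltr01).
rewrite !near_withinE => h.
(* Near [t] the difference quotient has norm below [|f' t| + 1], so on a ball of this radius the
   increment of [f] stays below [e]. *)
have r0 : 0 < e / (`|f' t| + 1) by rewrite divr_gt0// ltr_wpDl.
have := nbhsx_ballx t _ r0.
move: h; apply: filterS2 => s hs; rewrite /ball/= => ts s0.
have [->|st] := eqVneq s t; first by rewrite subrr normr0.
have {hs} := hs st s0.
set Q := _ *: _ => hQ.
have nQ : `|Q| < `|f' t| + 1.
  have -> : Q = f' t - (f' t - Q) by rewrite opprB addrC subrK.
  by rewrite (le_lt_trans (ler_normB _ _))// ltrD2l.
have -> : f t - f s = (t - s) *: Q.
  rewrite /Q scalerA -(opprB s t) mulNr divff ?subr_eq0//.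
  by rewrite scaleN1r opprB.
rewrite normrZ.
have p0 : 0 < `|f' t| + 1 by rewrite ltr_wpDl.
move: ts; rewrite ltr_pdivlMr// => ts.
apply: le_lt_trans ts; apply: ler_wpM2l => //; exact: ltW.
Qed.

Lemma derivative_on_halfline_continuous (V : normedModType R) (f f' : R -> V) :
  derivative_on_halfline f f' -> {within halfline, continuous f}.
Proof.
move=> df; apply/subspace_continuousP => t; rewrite /= in_itv/= andbT => t0.
exact: derivative_on_halfline_cvg df t0.
Qed.

Lemma derivative_on_halfline_cst (k : R) :
  derivative_on_halfline (cst k : R -> R^o) (cst 0).
Proof.
by move=> t t0 /=; under eq_fun do rewrite subrr scaler0; exact: cvg_cst.
Qed.

Lemma derivative_on_halflineD f f' g g' :
  derivative_on_halfline (f : R -> R^o) f' ->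
  derivative_on_halfline (g : R -> R^o) g' ->
  derivative_on_halfline (fun t => f t + g t : R^o) (fun t => f' t + g' t).
Proof.
move=> df dg t t0.
rewrite [X in X @ _ --> _](_ : _ = (fun s => (s - t)^-1 *: (f s - f t : R^o))
    \+ (fun s => (s - t)^-1 *: (g s - g t : R^o))).
  exact: cvgD (df t t0) (dg t t0).
by apply/funext => s; rewrite /= -scalerDr opprD addrACA.
Qed.

Lemma derivative_on_halflineM f f' g g' :
  derivative_on_halfline (f : R -> R^o) f' ->
  derivative_on_halfline (g : R -> R^o) g' ->
  derivative_on_halfline (fun t => f t * g t : R^o)
    (fun t => f' t * g t + f t * g' t).
Proof.
move=> df dg t t0.
have cg : g @ within halfline t^' --> g t.
  apply/cvgrPdist_lt => e e0.
  have /cvgrPdist_lt /(_ e e0) := derivative_on_halfline_cvg dg t0.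
  by rewrite !near_withinE; apply: filterS => s hs _; exact: hs.
have cf : (cst (f t) : R -> R^o) @ within halfline t^' --> f t by exact: cvg_cst.
(* The increment is split as [(f s - f t) * g s + f t * (g s - g t)], so only [g] has to be
   continuous at [t]. *)
rewrite [X in X @ _ --> _](_ : _ =
    (fun s => (s - t)^-1 * (f s - f t) * g s)
    \+ (fun s => f t * ((s - t)^-1 * (g s - g t)))).
  exact: cvgD (cvgM (df t t0) cg) (cvgM cf (dg t t0)).
by apply/funext => s; rewrite /= /GRing.scale/=; ring.
Qed.

Lemma derivative_on_halflineP f f' t : 0 < t ->
  derivative_on_halfline (f : R -> R^o) f' -> is_derive t (1 : R^o) f (f' t).
Proof.
move=> t0 /(_ t (ltW t0)) dft.
have h : (fun h : R => h^-1 *: ((f \o shift t) (h *: (1 : R^o)) - f t)) @ 0^' --> f' t.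
  apply/cvgrPdist_lt => e e0.
  move/cvgrPdist_lt : dft => /(_ e e0).
  rewrite !near_withinE => -[r /= r0 hr].
  (* A radius at most [t] keeps [s + t] in the half-line. *)
  exists (Num.min r t); first by rewrite /= lt_min r0.
  move=> s /=; rewrite sub0r normrN lt_min => /andP[sr st] s0.
  have := hr (s + t); rewrite /= opprD addrCA subrr addr0 normrN => /(_ sr).
  have st0 : s + t != t by rewrite -subr_eq0 addrK.
  move=> /(_ st0).
  have : s + t \in `[0, +oo[.
    by rewrite in_itv/= andbT; move: st; rewrite ltr_norml => /andP[]; lra.
  move=> st1 /(_ st1).
  by rewrite addrK /shift/= /GRing.scale/= mulr1.
split; first by apply/cvg_ex; exists (f' t).
by apply/cvg_lim => //; exact: h.
Qed.

Lemma is_derive_on_halfline f f' : (forall t : R, 0 <= t -> is_derive t (1 : R^o) f (f' t)) ->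
  derivative_on_halfline (f : R -> R^o) f'.
Proof.
move=> df t t0; have [dft dfE] := df t t0.
move: dft; rewrite /derivable => /cvg_ex[l hl].
have lE : l = f' t by rewrite -dfE; apply/esym/cvg_lim.
rewrite -lE; apply/cvgrPdist_lt => e e0.
move/cvgrPdist_lt : hl => /(_ e e0).
rewrite !near_withinE => -[r /= r0 hr].
exists r => // s /=; rewrite distrC => sr st s0.
have := hr (s - t); rewrite /= sub0r normrN => /(_ sr).
by rewrite subr_eq0 => /(_ st); rewrite /shift/= /GRing.scale/= mulr1 subrK.
Qed.

(** Two-sided derivatives are available at interior points, and one-sided continuity suffices at the
    left end; the interval may therefore start at 0. *)
Lemma derivative_on_halfline_MVT f f' a b : 0 <= a -> a < b ->
  derivative_on_halfline (f : R -> R^o) f' ->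
  exists2 s, a < s < b & f b - f a = f' s * (b - a).
Proof.
move=> a0 ab df.
have [||s /[!in_itv]/= sab fE] := @MVT R f f' a b ab; last by exists s.
- move=> x; rewrite in_itv/= => /andP[ax xb].
  by apply: derivative_on_halflineP => //; exact: le_lt_trans ax.
- apply: continuous_subspaceW (derivative_on_halfline_continuous df).
  by move=> x /=; rewrite !in_itv/= andbT => /andP[ax _]; exact: le_trans ax.
Qed.

Lemma derivative_on_halfline_le f f' t :
  derivative_on_halfline (f : R -> R^o) f' ->
  (forall s, 0 <= s -> f' s <= 0) -> 0 <= t -> f t <= f 0.
Proof.
move=> df f'0; rewrite le_eqVlt => /predU1P[<-//|t0].
have [s /andP[s0 st] fE] := derivative_on_halfline_MVT (lexx 0) t0 df.
rewrite -subr_le0 fE subr0 mulr_le0_ge0// ?f'0 ?ltW//.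
Qed.

Lemma ex_primitive_halfline (c : R -> R) : continuous c ->
  exists C : R -> R, forall t : R, 0 <= t -> is_derive t (1 : R^o) C (c t).
Proof.
move=> cc.
(* The base point -1 makes 0 an interior point, so the primitive has a two-sided derivative there as
   well. *)
exists (fun x => \int[@lebesgue_measure R]_(t in `[-1, x]) c t)%R => t t0.
have [] := @continuous_FTC1_closed R c (-1) t (t + 1).
- by rewrite ltrDl.
- apply: continuous_compact_integrable; first exact: segment_compact.
  exact: continuous_subspaceT.
- lra.
- exact: cc.
by move=> h1 h2; split; [exact: h1|rewrite -derive1E; exact: h2].
Qed.

End HalflineDerivative.

(** * Estimates for one spectral component *)

Section ScalarEquation.
Context {R : realType}.

Lemma positive_part_lipschitz (a b : R) :
  `|Num.max a 0 - Num.max b 0| <= `|a - b|.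
Proof.
have h1 := ler_norm (a - b); have := ler_norm (b - a); rewrite distrC => h2.
by rewrite ler_norml /Num.max; case: ltP => ?; case: ltP => ?; lra.
Qed.

(** The map [t -> max(t, 0)] is 1-Lipschitz, so composing [c] with it gives a function continuous on
    the whole line, by continuity of [omega] at 0; it agrees with [c] on the half-line. *)
Lemma continuity_modulus_primitive (omega c : R -> R) :
  continuity_modulus omega ->
  (forall a b : R, 0 <= a -> 0 <= b -> `|c a - c b| <= omega `|a - b|) ->
  exists C : R -> R, forall t : R, 0 <= t -> is_derive t (1 : R^o) C (c t).
Proof.
move=> [cw w0 _ wnd _] cM.
suff : continuous (fun t : R => c (Num.max t 0)).
  move=> /ex_primitive_halfline[C hC]; exists C => t t0.
  by have := hC t t0; rewrite max_l.
move=> t; apply/cvgrPdist_lt => e e0.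
move/subspace_continuousP : cw => /(_ 0).
rewrite /= in_itv/= lexx => /(_ isT) /cvgrPdist_lt /(_ e e0).
rewrite near_withinE => -[r /= r0 hr].
exists r => // s /= ts.
have /= : `|0 - `|t - s| | < r by rewrite sub0r normrN normr_id.
move=> /hr; rewrite in_itv/= andbT normr_ge0 => /(_ isT).
rewrite /from_subspace w0 sub0r normrN => h.
rewrite (le_lt_trans _ h)//.
apply: le_trans (ler_norm _).
apply: le_trans (cM _ _ _ _) _; [by rewrite le_max lexx orbT..|].
by apply: wnd => //; exact: positive_part_lipschitz.
Qed.

(** Multiply by [2 * a] and complete the square in [y']; the hypothesis says that the discriminant
    is nonpositive. In the energy argument this form is minus the derivative of the energy. *)
Lemma damped_form_ge0 (a p q y y' : R) : 0 < a -> q ^+ 2 <= 2 * a * p ->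
  0 <= 2 * a * y' ^+ 2 - 2 * q * y * y' + p * y ^+ 2.
Proof.
move=> a0 qp.
rewrite -(@pmulr_rge0 _ (2 * a)) ?mulr_gt0//.
have -> : 2 * a * (2 * a * y' ^+ 2 - 2 * q * y * y' + p * y ^+ 2) =
  (2 * a * y' - q * y) ^+ 2 + (2 * a * p - q ^+ 2) * y ^+ 2 by ring.
by rewrite addr_ge0 ?sqr_ge0// mulr_ge0 ?sqr_ge0 ?subr_ge0.
Qed.

Variables (omega c : R -> R) (mu1 mu2 sigma delta : R).
Hypotheses (mu1_gt0 : 0 < mu1)
  (c_bounds : forall t : R, 0 <= t -> mu1 <= c t <= mu2)
  (omega_modulus : continuity_modulus omega)
  (c_omega : forall a b : R, 0 <= a -> 0 <= b -> `|c a - c b| <= omega `|a - b|)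
  (sigma_bounds : 0 <= sigma <= 1 / 2)
  (delta_gt0 : 0 < delta).

(* [ce t] is the average of [c] over [[t, t + 1 / l]]. *)
Lemma ex_coefficient_average (l : R) : 0 < l ->
  exists ce ce' : R -> R, derivative_on_halfline (ce : R -> R^o) ce' /\
    forall t : R, 0 <= t -> [/\ mu1 <= ce t <= mu2,
      `|ce t - c t| <= omega (1 / l) & ce' t <= l * omega (1 / l)].
Proof.
move=> l0; have [C hC] := continuity_modulus_primitive omega_modulus c_omega.
have [_ w0 _ wnd _] := omega_modulus.
have il0 : 0 < 1 / l by rewrite divr_gt0.
exists (fun t => l * (C (t + 1 / l) - C t)).
exists (fun t => l * (c (t + 1 / l) - c t)); split.
  apply: is_derive_on_halfline => t t0.
  have t1 : 0 <= t + 1 / l by rewrite addr_ge0// ltW.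
  have d1 := @is_derive1_comp R C (shift (1 / l)) t _ _ (hC _ t1) (is_derive_shift t 1 (1 / l)).
  apply: is_derive_eq (is_deriveZ l (is_deriveB d1 (hC t t0))) _.
  by rewrite mulr1.
move=> t t0.
have dC := is_derive_on_halfline hC.
have tt : t < t + 1 / l by rewrite ltrDl.
(* The average is a value [c s] with [t < s < t + 1 / l], which gives its bounds and its distance to
   [c t] at once. *)
have [s /andP[ts st] sE] := derivative_on_halfline_MVT t0 tt dC.
have -> : l * (C (t + 1 / l) - C t) = c s.
  by rewrite sE; field; rewrite gt_eqF.
have s0 : 0 <= s by rewrite (le_trans t0)// ltW.
split; first exact: c_bounds.
  apply: le_trans (c_omega s0 t0) _; apply: wnd => //.
  by rewrite ger0_norm ?subr_ge0 1?ltW//; lra.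
rewrite ler_pM2l//.
apply: le_trans (ler_norm _) _.
apply: le_trans (c_omega _ t0) _; first by rewrite addr_ge0// ltW.
by rewrite addrAC subrr add0r ger0_norm// ltW.
Qed.

Lemma ode_solution_derivatives (l : R) (y y' : R -> R) (y0 y1 : R) :
  ode_solution delta sigma c l y y' y0 y1 ->
  [/\ derivative_on_halfline (y : R -> R^o) y',
      derivative_on_halfline (y' : R -> R^o)
        (fun t => - (2 * (delta * l `^ (2 * sigma)) * y' t + l ^+ 2 * c t * y t)),
      y 0 = y0 & y' 0 = y1].
Proof.
move=> [y'' [dy dy' eq00 ? ?]]; split=> // t t0.
have -> : - (2 * (delta * l `^ (2 * sigma)) * y' t + l ^+ 2 * c t * y t) = y'' t.
  by have := eq00 t t0; lra.
exact: dy'.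
Qed.

(** No coefficient depends on [t], and [l] enters only through the weight of [y], so the bound can
    be integrated over all high frequencies. *)
Lemma high_frequency_estimate (l : R) (y y' : R -> R) (y0 y1 : R) : 1 <= l ->
  (l `^ (1 - 2 * sigma) * omega (1 / l)) ^+ 2
    + 2 * delta * (l `^ (1 - 2 * sigma) * omega (1 / l)) <= 4 * delta ^+ 2 * mu1 ->
  ode_solution delta sigma c l y y' y0 y1 -> forall t, 0 <= t ->
  y' t ^+ 2 + 2 * mu1 * (l * y t) ^+ 2
    <= 4 * y1 ^+ 2 + 2 * (3 * delta ^+ 2 + mu2) * (l * y0) ^+ 2.
Proof.
move=> l1 cond /ode_solution_derivatives[dy dy' y0E y1E] t t0.
have l0 : 0 < l by rewrite (lt_le_trans ltr01).
have [ce [ce' [dce hce]]] := ex_coefficient_average l0.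
set L := l `^ (2 * sigma) in dy'.
have L0 : 0 < L by rewrite powR_gt0.
(* Here [2 * sigma <= 1] and [l >= 1] are used. It gives [a <= delta * l], so that [a * y0] is
   controlled by [l * y0]. *)
have Ll : L <= l.
  have /andP[s0 s1] := sigma_bounds.
  by rewrite /L -[leRHS]powRr1 ?(ltW l0)// ler_powR//; lra.
set w := omega (1 / l) in cond hce.
have w0 : 0 <= w.
  by have [_ _ wp _ _] := omega_modulus; rewrite ltW// wp// divr_gt0.
have lL : l `^ (1 - 2 * sigma) = l / L.
  by rewrite powRB ?(gt_eqF l0) ?implybT// powRr1// ltW.
rewrite lL in cond.
pose a := delta * L.
have a0 : 0 < a by rewrite mulr_gt0.
have ad : a ^+ 2 <= delta ^+ 2 * l ^+ 2.
  have al : a <= delta * l by rewrite ler_pM2l.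
  by rewrite -exprMn lerXn2r// nnegrE ?(le_trans _ al)// ltW.
(* The hypothesis multiplied by [(l * L) ^+ 2]: this is the discriminant condition in its worst
   case. *)
have {}cond : (l ^+ 2 * w) ^+ 2 + 2 * a * (l ^+ 3 * w) <= 4 * a ^+ 2 * mu1 * l ^+ 2.
  have lL2 : 0 <= (l * L) ^+ 2 by rewrite sqr_ge0.
  have := ler_wpM2r lL2 cond.
  congr (_ <= _); rewrite /a; last by ring.
  by field; rewrite gt_eqF.
(* the energy [(y' + a y)^2 + (l^2 ce + a^2) y^2], expanded *)
have dE := derivative_on_halflineD
  (derivative_on_halflineM dy' dy')
  (derivative_on_halflineD
    (derivative_on_halflineM
      (derivative_on_halflineD
        (derivative_on_halflineM (derivative_on_halfline_cst (l ^+ 2)) dce)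
        (derivative_on_halfline_cst (2 * a ^+ 2)))
      (derivative_on_halflineM dy dy))
    (derivative_on_halflineM (derivative_on_halfline_cst (2 * a))
      (derivative_on_halflineM dy dy'))).
have /= := derivative_on_halfline_le dE _ t0.
rewrite y0E y1E => E; lapply E; clear E; last first.
  move=> s s0; have [/andP[cs1 _] cew cew'] := hce s s0.
  have /andP[c1 _] := c_bounds s0.
  rewrite -/a.
  have := @damped_form_ge0 a (2 * a * l ^+ 2 * c s - l ^+ 2 * ce' s)
    (l ^+ 2 * (ce s - c s)) (y s) (y' s) a0.
  (* It follows from [cond] and the three bounds [|ce - c| <= w], [ce' <= l * w] and [c >= mu1]. *)
  suff h : (l ^+ 2 * (ce s - c s)) ^+ 2 <=
      2 * a * (2 * a * l ^+ 2 * c s - l ^+ 2 * ce' s).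
    move=> /(_ h); rewrite -oppr_le0; apply: le_trans.
    by rewrite le_eqVlt; apply/orP; left; apply/eqP; ring.
  have q2 : (l ^+ 2 * (ce s - c s)) ^+ 2 <= (l ^+ 2 * w) ^+ 2.
    have q1 : `|l ^+ 2 * (ce s - c s)| <= l ^+ 2 * w.
      by rewrite normrM ger0_norm ?sqr_ge0// ler_wpM2l ?sqr_ge0.
    by rewrite -[leLHS]real_normK ?num_real// lerXn2r// nnegrE (le_trans _ q1).
  have h1 : 4 * a ^+ 2 * l ^+ 2 * mu1 <= 4 * a ^+ 2 * l ^+ 2 * c s.
    by rewrite ler_wpM2l// !mulr_ge0// ltW.
  have h2 : 2 * a * l ^+ 2 * ce' s <= 2 * a * l ^+ 2 * (l * w).
    by rewrite ler_wpM2l// !mulr_ge0// ltW.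
  move: cond q2 h1 h2; lra.
have [/andP[ct1 _] _ _] := hce t t0.
have [/andP[_ c02] _ _] := hce 0 (lexx 0).
move=> E.
have h1 : l ^+ 2 * mu1 * y t ^+ 2 <= l ^+ 2 * ce t * y t ^+ 2.
  by rewrite ler_wpM2r ?sqr_ge0// ler_wpM2l ?sqr_ge0.
have h2 : l ^+ 2 * ce 0 * y0 ^+ 2 <= l ^+ 2 * mu2 * y0 ^+ 2.
  by rewrite ler_wpM2r ?sqr_ge0// ler_wpM2l ?sqr_ge0.
have h3 : a ^+ 2 * y0 ^+ 2 <= delta ^+ 2 * l ^+ 2 * y0 ^+ 2.
  by rewrite ler_wpM2r ?sqr_ge0.
(* Twice the energy at [t] equals [y'^2 + (y' + 2 a y)^2 + 2 l^2 ce y^2]. At time 0 the cross term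
   is absorbed by [2 (y1 - a y0)^2], whence the constants [4] and [3 * delta ^+ 2]. *)
have h4 := sqr_ge0 (y' t + 2 * a * y t).
have h5 := sqr_ge0 (y1 - a * y0).
move: E h1 h2 h3 h4 h5; rewrite !expr2; lra.
Qed.

(** For [l <= nu] the coefficients of the equation without damping are bounded, and the damping only
    lowers [y'^2 + y^2]. The term [y^2] carries no factor [l] because [l] may vanish. Exponential
    growth is harmless on bounded time intervals. *)
Lemma low_frequency_estimate (nu l : R) (y y' : R -> R) (y0 y1 : R) :
  0 <= l <= nu -> ode_solution delta sigma c l y y' y0 y1 ->
  forall t, 0 <= t ->
  y' t ^+ 2 + y t ^+ 2 <= (y1 ^+ 2 + y0 ^+ 2) * expR ((1 + nu ^+ 2 * mu2) * t).
Proof.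
move=> /andP[l0 ln] /ode_solution_derivatives[dy dy' y0E y1E] t t0.
set K := 1 + nu ^+ 2 * mu2.
have dexp : derivative_on_halfline (fun t => expR (- K * t) : R^o)
    (fun t => - K * expR (- K * t)).
  apply: is_derive_on_halfline => s _.
  have d1 := @is_derive1_comp R expR ( *%R (- K)) s _ _
    (is_derive_expR _) (is_deriveZ (- K) (is_derive_id s 1)).
  by apply: is_derive_eq d1 _; rewrite /GRing.scale/= mulr1 mulrC.
(* Gronwall: [(y'^2 + y^2) exp(- K t)] is nonincreasing *)
have dE := derivative_on_halflineM
  (derivative_on_halflineD
    (derivative_on_halflineM dy' dy') (derivative_on_halflineM dy dy)) dexp.
have /= := derivative_on_halfline_le dE _ t0.
rewrite y0E y1E mulr0 expR0 mulr1 => E; lapply E; clear E; last first.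
  move=> s s0; have /andP[c1 c2] := c_bounds s0.
  set a := delta * _.
  have a0 : 0 <= a by rewrite mulr_ge0 ?powR_ge0// ltW.
  set P := y' s * y' s + y s * y s.
  have -> : forall X e, X * e + P * (- K * e) = (X - K * P) * e by move=> *; ring.
  rewrite mulr_le0_ge0 ?expR_ge0//.
  have lc : 0 <= l ^+ 2 * c s <= nu ^+ 2 * mu2.
    have cs0 : 0 <= c s := le_trans (ltW mu1_gt0) c1.
    have ln2 : l ^+ 2 <= nu ^+ 2 by rewrite lerXn2r// nnegrE (le_trans l0).
    by rewrite mulr_ge0 ?sqr_ge0//= ler_pM ?sqr_ge0.
  move: lc => /andP[lc0 lc1].
  (* From [(y - y')^2 >= 0] and [l^2 c (y + y')^2 >= 0]. *)
  have P1 : 2 * (1 - l ^+ 2 * c s) * (y s * y' s) <= (1 + l ^+ 2 * c s) * P.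
    have h1 := sqr_ge0 (y s - y' s); have h2 := mulr_ge0 lc0 (sqr_ge0 (y s + y' s)).
    move: h1 h2; rewrite /P !expr2; lra.
  have P2 : (1 + l ^+ 2 * c s) * P <= K * P.
    by rewrite ler_wpM2r ?lerD2l// /P addr_ge0// -expr2 sqr_ge0.
  have P3 : 0 <= a * (y' s * y' s) by rewrite mulr_ge0// -expr2 sqr_ge0.
  move: P1 P2 P3; rewrite /P; lra.
move=> h.
rewrite -ler_pdivrMr ?expR_gt0// -expRN -mulNr !expr2; exact: h.
Qed.

(** The two frequency ranges have separate constants; their sum serves every [l >= 0]. The weight
    [1 + l] is that of the norm of [D(A^(1/2))]. *)
Lemma ode_solution_estimate (nu T : R) : 1 <= nu -> 0 <= T ->
  (forall l : R, nu <= l ->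
    (l `^ (1 - 2 * sigma) * omega (1 / l)) ^+ 2
      + 2 * delta * (l `^ (1 - 2 * sigma) * omega (1 / l)) <= 4 * delta ^+ 2 * mu1) ->
  exists2 K, 0 <= K & forall (l : R) (y y' : R -> R) (y0 y1 : R), 0 <= l ->
    ode_solution delta sigma c l y y' y0 y1 -> forall t, 0 <= t <= T ->
    y' t ^+ 2 + ((1 + l) * y t) ^+ 2 <= K * (y1 ^+ 2 + ((1 + l) * y0) ^+ 2).
Proof.
move=> nu1 T0 cond.
have mu20 : 0 <= mu2.
  by have /andP[h1 h2] := c_bounds (lexx 0); rewrite (le_trans _ (le_trans h1 h2))// ltW.
(* In [K1] the factor [(1 + nu) ^+ 2] restores the weight and the exponential is the Gronwall factor
   at time [T]. In [K2] the factor [1 + 2 / mu1] comes from [(1 + l)^2 <= 4 l^2], valid for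
   [l >= 1]. *)
pose K1 := (1 + nu) ^+ 2 * expR ((1 + nu ^+ 2 * mu2) * T).
pose K2 := (1 + 2 / mu1) * (4 + 2 * (3 * delta ^+ 2 + mu2)).
have K10 : 0 <= K1 by rewrite mulr_ge0 ?sqr_ge0 ?expR_ge0.
have B0 : 0 <= 2 * (3 * delta ^+ 2 + mu2).
  by rewrite mulr_ge0// addr_ge0// mulr_ge0// sqr_ge0.
have i0 : 0 <= 2 / mu1 by rewrite divr_ge0// ltW.
have K20 : 0 <= K2 by rewrite mulr_ge0// addr_ge0.
exists (K1 + K2); first by rewrite addr_ge0.
move=> l y y' y0 y1 l0 sol t /andP[t0 tT].
have S0 : 0 <= y1 ^+ 2 + ((1 + l) * y0) ^+ 2 by rewrite addr_ge0 ?sqr_ge0.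
rewrite (mulrDl K1 K2); have [ln|/ltW nl] := lerP l nu.
  apply: ler_wpDr; first by rewrite mulr_ge0.
  have := low_frequency_estimate (introT andP (conj l0 ln)) sol t0 => h.
  have ln2 : 1 <= (1 + l) ^+ 2 <= (1 + nu) ^+ 2.
    by rewrite exprn_ege1 ?lerDl//= lerXn2r ?nnegrE ?lerD2l//; lra.
  move: ln2 => /andP[l2 ln2].
  have h1 : y' t ^+ 2 + ((1 + l) * y t) ^+ 2 <= (1 + nu) ^+ 2 * (y' t ^+ 2 + y t ^+ 2).
    rewrite mulrDr exprMn lerD//; last by rewrite ler_wpM2r ?sqr_ge0.
    by rewrite ler_peMl ?sqr_ge0// (le_trans l2).
  apply: (le_trans h1); rewrite /K1 -mulrA ler_wpM2l ?sqr_ge0//.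
  apply: (le_trans h); rewrite mulrC ler_pM ?expR_ge0 ?addr_ge0 ?sqr_ge0//.
    rewrite ler_expR ler_wpM2l// addr_ge0// mulr_ge0// sqr_ge0//.
  by rewrite lerD2l exprMn ler_peMl ?sqr_ge0.
apply: ler_wpDl; first by rewrite mulr_ge0.
have l1 := le_trans nu1 nl.
have h := high_frequency_estimate l1 (cond l nl) sol t0.
set X := y' t ^+ 2 + 2 * mu1 * (l * y t) ^+ 2 in h.
have h1 : y' t ^+ 2 + ((1 + l) * y t) ^+ 2 <= (1 + 2 / mu1) * X.
  have -> : (1 + 2 / mu1) * X = X + 2 / mu1 * y' t ^+ 2 + 4 * (l * y t) ^+ 2.
    by rewrite /X; field; rewrite gt_eqF.
  have q1 : 0 <= 2 / mu1 * y' t ^+ 2 by rewrite mulr_ge0// sqr_ge0.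
  have q2 : 0 <= 2 * mu1 * (l * y t) ^+ 2 by rewrite mulr_ge0 ?sqr_ge0// mulr_ge0// ltW.
  have q3 : ((1 + l) * y t) ^+ 2 <= 4 * (l * y t) ^+ 2.
    rewrite !exprMn [leRHS]mulrA ler_wpM2r ?sqr_ge0//.
    have -> : 4 * l ^+ 2 = (2 * l) ^+ 2 by ring.
    by rewrite lerXn2r ?nnegrE//; lra.
  rewrite {1}/X; move: q1 q2 q3; lra.
apply: (le_trans h1); rewrite /K2 -mulrA ler_wpM2l ?addr_ge0//.
apply: (le_trans h); rewrite (mulrDl 4).
have q1 : 0 <= y1 ^+ 2 by exact: sqr_ge0.
have q2 : (l * y0) ^+ 2 <= ((1 + l) * y0) ^+ 2.
  by rewrite !exprMn ler_wpM2r ?sqr_ge0// lerXn2r ?nnegrE//; lra.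
have q3 : 0 <= (l * y0) ^+ 2 by exact: sqr_ge0.
apply: lerD.
  by rewrite ler_wpM2l// lerDl sqr_ge0.
by rewrite ler_wpM2l// (le_trans q2)// lerDr.
Qed.

End ScalarEquation.

(** * A frequency threshold from the limsup condition *)

(** The inequality for the limsup is strict, so it survives, in weak form, for some [L] strictly
    above the limsup. The quotient is below [L] for small [e], and [e = 1 / l] turns this into a
    statement about large [l]. *)
Lemma ex_high_frequency (R : realType) (omega : R -> R) (mu1 sigma delta : R) :
  continuity_modulus omega -> 0 < mu1 -> 0 < delta ->
  ((4 * delta ^+ 2 * mu1)%:E >
    Lambda_infty omega sigma ^+ 2
      + (2 * delta)%:E * Lambda_infty omega sigma)%E ->
  exists2 nu : R, 1 <= nu & forall l : R, nu <= l ->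
    (l `^ (1 - 2 * sigma) * omega (1 / l)) ^+ 2
      + 2 * delta * (l `^ (1 - 2 * sigma) * omega (1 / l))
    <= 4 * delta ^+ 2 * mu1.
Proof.
move=> [_ _ wp _ _] mu1p dp; set P := 4 * delta ^+ 2 * mu1; set La := Lambda_infty _ _.
move=> hLa.
have P0 : 0 < P by rewrite mulr_gt0// mulr_gt0// exprn_gt0.
have bump (r : R) : 0 <= r -> r ^+ 2 + 2 * delta * r < P ->
    exists2 L, r < L & L ^+ 2 + 2 * delta * L <= P.
  move=> r0 rP; set D := 2 * r + 1 + 2 * delta.
  have D0 : 0 < D by rewrite /D; lra.
  (* Since [h <= 1] gives [h^2 <= h], moving from [r] to [r + h] raises the left side by at most
     [h * D], which fits in the gap. *)
  set h := Num.min 1 ((P - (r ^+ 2 + 2 * delta * r)) / D).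
  have h0 : 0 < h by rewrite /h lt_min ltr01 divr_gt0// subr_gt0.
  have h1 : h <= 1 by rewrite /h ge_min lexx.
  have h2 : h * D <= P - (r ^+ 2 + 2 * delta * r).
    by rewrite -ler_pdivlMr// /h ge_min lexx orbT.
  exists (r + h); first by rewrite ltrDl.
  have h3 : h ^+ 2 <= h by rewrite expr2 ler_piMl// ltW.
  by move: h2 h3; rewrite /D !expr2; lra.
have [L [L0 LaL LP]] : exists L : R, [/\ 0 < L, (La < L%:E)%E & L ^+ 2 + 2 * delta * L <= P].
  (* A negative or [-oo] limsup is replaced by 0 before enlarging; [+oo] contradicts the
     hypothesis. *)
  move: hLa; case: La => [r| |].
  - rewrite -EFin_expe -EFinM -EFinD lte_fin => rP.
    have [r0|/ltW r0] := lerP 0 r.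
      by have [L rL LP] := bump r r0 rP; exists L; rewrite lte_fin rL (le_lt_trans r0).
    have [|L rL LP] := bump 0 (lexx 0); first by rewrite expr0n mulr0 addr0.
    by exists L; rewrite lte_fin rL (le_lt_trans r0).
  - by rewrite /expe/= mulyy gt0_muley ?lte_fin ?mulr_gt0// ltNge leey.
  - move=> _; have [|L rL LP] := bump 0 (lexx 0); first by rewrite expr0n mulr0 addr0.
    by exists L; rewrite ltNyr rL.
move: LaL; rewrite /La /Lambda_infty limf_esupE => /ereal_inf_lt[_ [V [r /= r0 rV] <-] VL].
have r1 : 0 < r^-1 by rewrite invr_gt0.
(* Beyond this threshold [1 / l < r], where the quotient is below [L]. *)
exists (1 + r^-1); first by rewrite lerDl ltW.
move=> l rl.
have l0 : 0 < l by apply: lt_le_trans rl; rewrite addr_gt0.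
have Vl : V (1 / l).
  apply: rV; last by rewrite divr_gt0.
  rewrite /= sub0r normrN div1r gtr0_norm ?invr_gt0// -[ltRHS]invrK ltf_pV2 ?posrE//.
  by apply: lt_le_trans rl; rewrite ltrDr.
have gL : omega (1 / l) / (1 / l) `^ (1 - 2 * sigma) < L.
  rewrite -lte_fin; apply: le_lt_trans VL.
  by apply: ereal_sup_ubound; exists (1 / l).
have gE : l `^ (1 - 2 * sigma) * omega (1 / l) =
    omega (1 / l) / (1 / l) `^ (1 - 2 * sigma).
  have -> : (1 / l) `^ (1 - 2 * sigma) = (l `^ (1 - 2 * sigma))^-1.
    by rewrite div1r -powR_inv1 ?(ltW l0)// -powRrM mulN1r powRN.
  by rewrite invrK mulrC.
rewrite -gE in gL.
have g0 : 0 <= l `^ (1 - 2 * sigma) * omega (1 / l).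
  by rewrite mulr_ge0 ?powR_ge0// ltW// wp// divr_gt0.
apply: le_trans LP; apply: lerD.
  by rewrite lerXn2r// ?nnegrE// ltW.
by rewrite ler_wpM2l ?mulr_ge0 ?ltW.
Qed.

(** * Dominated convergence of squares *)

(** If convergence fails, choosing bad points at distance below [1 / (n + 1)] from [t] gives a
    sequence contradicting the hypothesis. This brings dominated convergence, a theorem on
    sequences, to a real parameter. *)
Lemma cvg_within_seq (R : realType) (V : normedModType R) (A : set R) (t : R)
    (F : R -> V) (l : V) :
  (forall u : nat -> R, (forall n, A (u n)) -> u @ \oo --> t ->
    F (u n) @[n --> \oo] --> l) ->
  F @ within A (nbhs t) --> l.
Proof.
move=> H; apply: contrapT => Fl.
have [e e0 He] : exists2 e, 0 < e & forall d : R, 0 < d -> exists s,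
    [/\ A s, `|t - s| < d & e <= `|l - F s|].
  apply: contrapT => h; apply: Fl; apply/cvgrPdist_lt => e e0.
  apply: contrapT => h'; apply: h; exists e => // d d0.
  apply: contrapT => h; apply: h'; rewrite near_withinE.
  exists d => //= s ts As; rewrite ltNge; apply/negP => es.
  by apply: h; exists s.
have n0 (n : nat) : 0 < n.+1%:R^-1 :> R by rewrite invr_gt0.
have [u uP] := choice (fun n => He _ (n0 n)).
have ut : u @ \oo --> t.
  apply/cvgrPdist_lt => d d0; near=> n.
  have [_ ud _] := uP n; apply: (lt_trans ud).
  by near: n; exact: near_infty_natSinv_lt (PosNum d0).
have uA n : A (u n) by have [] := uP n.
have /cvgrPdist_lt /(_ e e0) [N _ hN] := H u uA ut.
have [_ _] := uP N.
by rewrite leNgt => /negP; apply; exact: hN (leqnn N).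
Unshelve. all: by end_near. Qed.

Section SquareIntegrable.
Context (R : realType) (d : measure_display) (M : measurableType d).
Context (mu : {measure set M -> \bar R}).
Implicit Types (f g G : M -> R) (t : R).

(** The majorant is [4 * G], because [(a - b)^2 <= 2 a^2 + 2 b^2]. The exceptional null set in the
    domination of [W s] does not depend on [s], so it serves every sequence of parameters. *)
Lemma square_dominated_cvg (A : set R) t (W : R -> M -> R) (W0 G : M -> R) :
  (forall s, measurable_fun setT (W s)) -> measurable_fun setT W0 ->
  mu.-integrable setT (EFin \o G) ->
  {ae mu, forall xi, W0 xi ^+ 2 <= G xi} ->
  {ae mu, forall xi s, A s -> W s xi ^+ 2 <= G xi} ->
  {ae mu, forall xi, W ^~ xi @ within A (nbhs t) --> W0 xi} ->
  (fun s => fine (\int[mu]_xi ((W s xi - W0 xi) ^+ 2)%:E)%E)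
    @ within A (nbhs t) --> (0 : R).
Proof.
move=> mW mW0 iG W0G WG Wcvg.
apply: cvg_within_seq => u uA ut.
have mF n : measurable_fun setT (fun xi => (W (u n) xi - W0 xi) ^+ 2 : R).
  by apply: measurable_funX; exact: measurable_funB.
have [] := @dominated_convergence _ _ _ mu setT measurableT
  (fun n xi => ((W (u n) xi - W0 xi) ^+ 2)%:E) (cst 0%E) (fun xi => (4 * G xi)%:E).
- by move=> n; apply/measurable_EFinP; exact: mF.
- exact: measurable_cst.
- apply: filterS Wcvg => xi h _; apply/fine_cvgP; split; first by exists 0%N.
  have hu : W (u n) xi @[n --> \oo] --> W0 xi.
    apply: cvg_trans h; move=> B /= hB.
    by have [N _ hN] := ut _ hB; exists N => // n Nn; exact: hN n Nn (uA n).
  have h0 : W (u n) xi - W0 xi @[n --> \oo] --> (0 : R).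
    by rewrite -(subrr (W0 xi)); apply: cvgB => //; exact: cvg_cst.
  by rewrite /= -(mulr0 0); exact: (cvgM h0 h0).
- rewrite (_ : (fun xi => _) = (fun xi => 4%:E * (EFin \o G) xi)%E).
    exact: integrableZl.
  by apply/funext => xi; rewrite EFinM.
- apply: filterS2 W0G WG => xi h0 h n _; rewrite lee_fin/= ger0_norm ?sqr_ge0//.
  have := h _ (uA n); have := sqr_ge0 (W (u n) xi + W0 xi).
  move: h0; rewrite !expr2; lra.
move=> _ _; rewrite integral0 => /fine_cvgP[_]; exact.
Qed.

Lemma Lfun2_of_integral f : measurable_fun setT f ->
  (\int[mu]_xi (f xi ^+ 2)%:E < +oo)%E -> f \in Lfun mu 2%:E.
Proof.
move=> mf fi; rewrite inE; apply/andP; split; rewrite inE//=.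
rewrite /finite_norm; apply: (@lty_poweRy _ _ 2) => //.
rewrite poweR_Lnorm//.
rewrite (eq_integral (fun xi => (f xi ^+ 2)%:E))// => xi _.
by rewrite /= powR_mulrn// real_normK ?num_real.
Qed.

Lemma Lfun2_dominated f G : measurable_fun setT f ->
  mu.-integrable setT (EFin \o G) ->
  {ae mu, forall xi, f xi ^+ 2 <= G xi} -> f \in Lfun mu 2%:E.
Proof.
move=> mf iG fG; apply: Lfun2_of_integral => //.
have [mG] := integrableP _ _ _ iG; apply: le_lt_trans.
apply: ae_ge0_le_integral => //.
- by move=> xi _; rewrite lee_fin sqr_ge0.
- by apply/measurable_EFinP; exact: measurable_funX.
- exact: measurableT_comp.
- by apply: filterS fG => xi h _; rewrite lee_fin (le_trans h)// ler_norm.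
Qed.

End SquareIntegrable.

(** A majorant of [f'] on [[0, T]] thereby also bounds every difference quotient of [f] there. *)
Lemma difference_quotient_MVT (R : realType) (f f' : R -> R) (T s t : R) :
  derivative_on_halfline (f : R -> R^o) f' ->
  0 <= s <= T -> 0 <= t <= T -> s != t ->
  exists2 r, 0 <= r <= T & (s - t)^-1 * (f s - f t) = f' r.
Proof.
move=> df; wlog st : s t / s < t.
  move=> h sT tT; rewrite neq_lt => /orP[lt_st|lt_ts].
    by apply: h => //; rewrite lt_eqF.
  have [r rT rE] := h _ _ lt_ts tT sT (negbT (lt_eqF lt_ts)).
  by exists r; rewrite // -rE -(opprB t) invrN -(opprB (f t)) mulrNN.
move=> /andP[s0 _] /andP[_ tT] _.
have [r /andP[sr rt] rE] := derivative_on_halfline_MVT s0 st df.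
exists r; first by rewrite (le_trans s0 (ltW sr)) (le_trans (ltW rt) tT).
rewrite -(opprB t) invrN -(opprB (f t)) mulrNN rE mulrC mulfK//.
by rewrite subr_eq0 gt_eqF.
Qed.

(** Limits are local; cutting at [t + 1] leaves a bounded time interval, on which an integrable
    majorant exists. *)
Lemma cvg_within_halfline (R : realType) (V : normedModType R) (F : R -> V)
    (t : R) (l : V) :
  F @ within [set s | 0 <= s <= t + 1] (nbhs t) --> l ->
  F @ within `[0, +oo[ (nbhs t) --> l.
Proof.
move=> /cvgrPdist_lt Fl; apply/cvgrPdist_lt => e /Fl; rewrite !near_withinE.
have := nbhsx_ballx t 1 ltr01; apply: filterS2 => s /ltr_distlCDr ts h.
by rewrite /= in_itv/= andbT => s0; apply: h; rewrite /= s0 ltW.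
Qed.

Lemma cvg_within_halfline_punctured (R : realType) (V : normedModType R)
    (F : R -> V) (t : R) (l : V) :
  F @ within [set s | 0 <= s <= t + 1 /\ s != t] (nbhs t) --> l ->
  F @ within `[0, +oo[ t^' --> l.
Proof.
move=> /cvgrPdist_lt Fl; apply/cvgrPdist_lt => e /Fl; rewrite !near_withinE.
have := nbhsx_ballx t 1 ltr01; apply: filterS2 => s /ltr_distlCDr ts h st.
by rewrite /= in_itv/= andbT => s0; apply: h; rewrite /= s0 ltW.
Qed.

(** * Spectral calculus *)

Section SpectralCalculus.
Context (R : realType) (H : completeNormedModType R).
Context (d : measure_display) (M : measurableType d).
Context (mu : {measure set M -> \bar R}).
Context (lam : M -> R) (hat : H -> {mfun M >-> R}) (D : set H) (A : H -> H).
Hypothesis spec : spectral_representation mu lam hat D A.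
Implicit Types (x y z : H) (f : M -> R).

Let lam_ge0 xi : 0 <= lam xi := spec_lam_ge0 spec xi.
Let mlam : measurable_fun setT lam := spec_lam_measurable spec.
Let mhat x : measurable_fun setT (hat x).
Proof. exact: measurable_funPT. Qed.
Let mrep (W : R -> {mfun M >-> R}) t : measurable_fun setT (W t).
Proof. exact: measurable_funPT. Qed.

Lemma hatB x y : {ae mu, forall xi, hat (x - y) xi = hat x xi - hat y xi}.
Proof.
have := spec_hat_linear spec (-1) y x.
apply: filterS => xi; rewrite scaleN1r addrC => ->.
by rewrite mulN1r addrC.
Qed.

Lemma hatZ (a : R) x : {ae mu, forall xi, hat (a *: x) xi = a * hat x xi}.
Proof.
(* This instance says that [hat 0] vanishes almost everywhere. *)
have := spec_hat_linear spec (-1) 0 0.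
have := spec_hat_linear spec a x 0.
apply: filterS2 => xi; rewrite addr0 => ->.
by rewrite scaler0 addr0 mulN1r addNr => ->; rewrite addr0.
Qed.

Lemma norm2_hat x f : measurable_fun setT f ->
  {ae mu, forall xi, hat x xi = f xi} ->
  (`|x| ^+ 2)%:E = (\int[mu]_xi (f xi ^+ 2)%:E)%E.
Proof.
move=> mf xf; rewrite (spec_hat_isometry spec); apply: ae_eq_integral => //.
- by apply/measurable_EFinP; exact: measurable_funX.
- by apply/measurable_EFinP; exact: measurable_funX.
- by apply: filterS xf => xi h _; rewrite h.
Qed.

(** By the isometry, the squared distance in [H] is the integral of the squared difference of
    components, to which dominated convergence applies. *)
Lemma hat_dominated_cvg (S : set R) (t : R) (v : R -> H) (v0 : H) (W : R -> M -> R)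
    (W0 G : M -> R) :
  (forall s, measurable_fun setT (W s)) -> measurable_fun setT W0 ->
  (forall s, S s -> {ae mu, forall xi, hat (v s) xi = W s xi}) ->
  {ae mu, forall xi, hat v0 xi = W0 xi} ->
  mu.-integrable setT (EFin \o G) ->
  {ae mu, forall xi, W0 xi ^+ 2 <= G xi} ->
  {ae mu, forall xi s, S s -> W s xi ^+ 2 <= G xi} ->
  {ae mu, forall xi, W ^~ xi @ within S (nbhs t) --> W0 xi} ->
  v @ within S (nbhs t) --> v0.
Proof.
move=> mW mW0 vW v0W iG W0G WG Wcvg; apply/cvgrPdist_lt => e e0.
have /cvgrPdist_lt := square_dominated_cvg mW mW0 iG W0G WG Wcvg.
move=> /(_ (e ^+ 2)); rewrite exprn_gt0// => /(_ isT).
rewrite !near_withinE; apply: filterS => s h Ss; move: (h Ss).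
have -> : (\int[mu]_xi ((W s xi - W0 xi) ^+ 2)%:E)%E = (`|v s - v0| ^+ 2)%:E.
  apply/esym/norm2_hat; first exact: measurable_funB.
  have := hatB (v s) v0; apply: filterS3 (vW s Ss) v0W => xi h1 h2 ->.
  by rewrite h1 h2.
rewrite /= sub0r normrN ger0_norm ?sqr_ge0// distrC.
by rewrite ltr_pXn2r// ?nnegrE// ltW.
Qed.

(** Surjectivity onto L^2 provides a vector with these components, so the choice in
    [spectral_multiplier] does not fall back on its default 0. *)
Lemma hat_spectral_multiplier (m : M -> R) x f : f \in Lfun mu 2%:E ->
  {ae mu, forall xi, f xi = m xi * hat x xi} ->
  {ae mu, forall xi, hat (spectral_multiplier mu hat m x) xi = f xi}.
Proof.
move=> /(spec_hat_surjective spec)[y yf] fm.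
have : {ae mu, forall xi, hat (spectral_multiplier mu hat m x) xi = m xi * hat x xi}.
  apply: (@xgetPex _ 0 [set y | {ae mu, forall xi, hat y xi = m xi * hat x xi}]).
  by exists y => /=; apply: filterS2 yf fm => xi -> ->.
by apply: filterS2 fm => xi -> ->.
Qed.

Lemma Dnorm2_half x :
  Dnorm2 mu lam hat (1 / 2) x = (\int[mu]_xi (((1 + lam xi) * hat x xi) ^+ 2)%:E)%E.
Proof.
apply: eq_integral => xi _; congr _%:E.
have -> : 4 * (1 / 2) = 2%:R :> R by field.
by rewrite powR_mulrn ?addr_ge0// exprMn real_normK ?num_real.
Qed.

Lemma Dpow_half_integrable x : Dpow mu lam hat (1 / 2) x ->
  mu.-integrable setT (EFin \o (fun xi => ((1 + lam xi) * hat x xi) ^+ 2)).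
Proof.
rewrite /Dpow/= Dnorm2_half => xD; apply/integrableP; split.
  apply/measurable_EFinP; apply: measurable_funX; apply: measurable_funM => //.
  exact: measurable_funD.
move: xD; apply: le_lt_trans; rewrite le_eqVlt; apply/orP; left; apply/eqP.
by apply: eq_integral => xi _; rewrite /= ger0_norm// sqr_ge0.
Qed.

Let measurable_band nu : measurable_fun setT (\1_[set xi | nu <= lam xi] : M -> R).
Proof.
apply: measurable_indic; rewrite -[X in measurable X]setTI.
rewrite (_ : [set xi | _] = lam @^-1` `[nu, +oo[); first exact: mlam.
by apply/seteqP; split => xi /=; rewrite in_itv/= andbT.
Qed.

Lemma hat_high (nu : R) x :
  {ae mu, forall xi, hat (high mu lam hat nu x) xi =
     \1_[set xi | nu <= lam xi] xi * hat x xi}.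
Proof.
apply: hat_spectral_multiplier; last exact: aeW.
apply: Lfun2_dominated (Lfun2_integrable_sqr (spec_hat_L2 spec x)) _.
  exact: measurable_funM.
apply: aeW => xi; rewrite indicE; case: (_ \in _); first by rewrite mul1r.
by rewrite mul0r expr0n sqr_ge0.
Qed.

Lemma hat_Apow_high (nu : R) x : Dpow mu lam hat (1 / 2) x ->
  {ae mu, forall xi, hat (Apow mu lam hat (1 / 2) (high mu lam hat nu x)) xi =
     lam xi * (\1_[set xi | nu <= lam xi] xi * hat x xi)}.
Proof.
move=> xD; apply: hat_spectral_multiplier.
  apply: Lfun2_dominated (Dpow_half_integrable xD) _.
    by apply: measurable_funM => //; exact: measurable_funM.
  apply: aeW => xi; rewrite indicE; case: (_ \in _); last first.
    by rewrite mul0r mulr0 expr0n sqr_ge0.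
  rewrite mul1r !exprMn ler_wpM2r ?sqr_ge0//.
  by rewrite lerXn2r ?nnegrE ?addr_ge0 ?lerDr.
apply: filterS (hat_high nu x) => xi ->.
have -> : 2 * (1 / 2) = 1 :> R by field.
by rewrite powRr1.
Qed.

Lemma high_norm2 (nu : R) x :
  (`|high mu lam hat nu x| ^+ 2)%:E =
  (\int[mu]_xi ((\1_[set xi | nu <= lam xi] xi * hat x xi) ^+ 2)%:E)%E.
Proof. by apply: norm2_hat (hat_high nu x); exact: measurable_funM. Qed.

Lemma Apow_high_norm2 (nu : R) x : Dpow mu lam hat (1 / 2) x ->
  (`|Apow mu lam hat (1 / 2) (high mu lam hat nu x)| ^+ 2)%:E =
  (\int[mu]_xi ((lam xi * (\1_[set xi | nu <= lam xi] xi * hat x xi)) ^+ 2)%:E)%E.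
Proof.
move=> xD; apply: norm2_hat (hat_Apow_high nu xD).
by apply: measurable_funM => //; exact: measurable_funM.
Qed.

(** The squared norms are integrals of nonnegative functions, so the pointwise inequality is
    integrated in the extended reals. *)
Lemma high_energy_le (nu a b a0 b0 : R) (x x' x0 x1 : H) :
  0 <= b -> 0 <= a0 -> 0 <= b0 ->
  Dpow mu lam hat (1 / 2) x -> Dpow mu lam hat (1 / 2) x0 ->
  {ae mu, forall xi, nu <= lam xi ->
    hat x' xi ^+ 2 + b * (lam xi * hat x xi) ^+ 2
      <= a0 * hat x1 xi ^+ 2 + b0 * (lam xi * hat x0 xi) ^+ 2} ->
  `|high mu lam hat nu x'| ^+ 2
    + b * `|Apow mu lam hat (1 / 2) (high mu lam hat nu x)| ^+ 2
  <= a0 * `|high mu lam hat nu x1| ^+ 2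
    + b0 * `|Apow mu lam hat (1 / 2) (high mu lam hat nu x0)| ^+ 2.
Proof.
move=> b1 a01 b01 xD x0D le_xi.
have mh z : measurable_fun setT
    (fun xi => (\1_[set xi | nu <= lam xi] xi * hat z xi) ^+ 2 : R).
  by apply: measurable_funX; exact: measurable_funM.
have mlh z : measurable_fun setT
    (fun xi => (lam xi * (\1_[set xi | nu <= lam xi] xi * hat z xi)) ^+ 2 : R).
  by apply: measurable_funX; apply: measurable_funM => //; exact: measurable_funM.
have mk (k : R) f : measurable_fun setT f -> measurable_fun setT (fun xi => k * f xi).
  by move=> mf; exact: measurable_funM.
rewrite -lee_fin !EFinD (EFinM b) (EFinM a0) (EFinM b0) !high_norm2 !Apow_high_norm2//.
rewrite -!ge0_integralZl_EFin//; do ?[by move=> xi _; rewrite lee_fin sqr_ge0];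
  do ?[exact/measurable_EFinP].
rewrite -!ge0_integralD//; do ?[by move=> xi _; rewrite -?EFinM lee_fin ?sqr_ge0// mulr_ge0 ?sqr_ge0];
  do ?[by apply/measurable_EFinP; rewrite /=; exact: mk|exact/measurable_EFinP].
apply: ae_ge0_le_integral => //.
- by move=> xi _; rewrite -EFinM -EFinD lee_fin addr_ge0 ?sqr_ge0// mulr_ge0 ?sqr_ge0.
- by apply/measurable_EFinP; apply: measurable_funD => //; exact: mk.
- by move=> xi _; rewrite -!EFinM -EFinD lee_fin addr_ge0// mulr_ge0 ?sqr_ge0.
- by apply/measurable_EFinP; apply: measurable_funD; exact: mk.
(* Outside the band [nu <= lam xi] both sides are 0. *)
apply: filterS le_xi => xi h _; rewrite -!EFinM -!EFinD lee_fin indicE.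
case: (boolP (xi \in _)) => [|_]; last by rewrite !mul0r !mulr0 expr0n !mulr0.
by rewrite inE/= => /h; rewrite !mul1r.
Qed.

(** * From dominated components to curves in [H] *)

(** The time is quantified inside the almost-everywhere statement: a single null set serves all
    times up to [T]. *)
Definition locally_L2_dominated (W : R -> M -> R) : Prop := forall T : R,
  exists2 G : M -> R, mu.-integrable setT (EFin \o G) &
    {ae mu, forall xi (t : R), 0 <= t <= T -> W t xi ^+ 2 <= G xi}.

Lemma represents_ex (W : R -> {mfun M >-> R}) :
  locally_L2_dominated W -> exists u : R -> H, represents mu hat u W.
Proof.
move=> Wd; exists (fun t => xget 0 [set x | {ae mu, forall xi, hat x xi = W t xi}]).
move=> t t0; apply: (@xgetPex _ 0 [set x | {ae mu, forall xi, hat x xi = W t xi}]).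
apply: (spec_hat_surjective spec); have [G iG WG] := Wd t.
apply: Lfun2_dominated iG _; first exact: mrep.
by apply: filterS WG => xi; apply; rewrite t0 lexx.
Qed.

Lemma represents_continuous (u : R -> H) (W : R -> {mfun M >-> R}) :
  represents mu hat u W -> locally_L2_dominated W ->
  {ae mu, forall xi (t : R), 0 <= t ->
    W ^~ xi @ within `[0, +oo[ (nbhs t) --> W t xi} ->
  {within `[0, +oo[, continuous u}.
Proof.
move=> uW Wd Wc; apply/subspace_continuousP => t; rewrite /= in_itv/= andbT => t0.
apply: cvg_within_halfline; have [G iG WG] := Wd (t + 1).
apply: (@hat_dominated_cvg _ t u (u t) W (W t) G) => //.
- by move=> s /andP[s0 _]; exact: uW.
- exact: uW.
- by apply: filterS WG => xi; apply; rewrite t0 lerDl ler01.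
- apply: filterS Wc => xi /(_ t t0); apply: cvg_trans; apply: cvg_app.
  by apply: within_subset => s /= /andP[s0 _]; rewrite in_itv/= s0.
Qed.

(** Domination of [W'] is enough: by the mean value theorem the difference quotients of [W] are
    values of [W'], hence share its majorant. *)
Lemma represents_derivative (u u' : R -> H) (W W' : R -> {mfun M >-> R}) :
  represents mu hat u W -> represents mu hat u' W' -> locally_L2_dominated W' ->
  {ae mu, forall xi,
    derivative_on_halfline (W ^~ xi : R -> R^o) (W' ^~ xi)} ->
  derivative_on_halfline u u'.
Proof.
move=> uW uW' Wd Wc t t0; apply: cvg_within_halfline_punctured.
have [G iG WG] := Wd (t + 1).
have tT : 0 <= t <= t + 1 by rewrite t0 lerDl ler01.
apply: (@hat_dominated_cvg _ t _ (u' t)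
  (fun s xi => (s - t)^-1 * (W s xi - W t xi)) (W' t) G) => //.
- move=> s; apply: measurable_funM => //; apply: measurable_funB; exact: mrep.
- move=> s [/andP[s0 _] _].
  have : {ae mu, forall xi, hat ((s - t)^-1 *: (u s - u t)) xi =
      (s - t)^-1 * (hat (u s) xi - hat (u t) xi)}.
    by apply: filterS2 (hatZ (s - t)^-1 (u s - u t)) (hatB (u s) (u t)) => xi -> ->.
  by apply: filterS3 (uW s s0) (uW t t0) => xi -> ->.
- exact: uW'.
- by apply: filterS WG => xi; apply.
- apply: filterS2 Wc WG => xi dW h s [sT st].
  by have [r /h] := difference_quotient_MVT dW sT tT st; move=> + ->.
- apply: filterS Wc => xi /(_ t t0); rewrite /GRing.scale/=.
  move=> /cvgrPdist_lt dW; apply/cvgrPdist_lt => e /dW.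
  rewrite !near_withinE; apply: filterS => s h [/andP[s0 _] st].
  by apply: h => //; rewrite /= in_itv/= s0.
Qed.

(** The norm of [D(A^(1/2))] is the L^2 norm of the components weighted by [1 + lam], so dominated
    convergence is applied to the weighted components. *)
Lemma represents_C0_Dpow_half (u : R -> H) (W : R -> {mfun M >-> R}) :
  represents mu hat u W ->
  locally_L2_dominated (fun t xi => (1 + lam xi) * W t xi) ->
  {ae mu, forall xi (t : R), 0 <= t ->
    W ^~ xi @ within `[0, +oo[ (nbhs t) --> W t xi} ->
  C0_Dpow mu lam hat (1 / 2) u.
Proof.
move=> uW Wd Wc t t0; have [G iG WG] := Wd (t + 1).
have mlW s : measurable_fun setT (fun xi => (1 + lam xi) * W s xi).
  by apply: measurable_funM; [exact: measurable_funD|exact: mrep].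
have tT : 0 <= t <= t + 1 by rewrite t0 lerDl ler01.
split.
  rewrite /Dpow/= Dnorm2_half.
  have [mG] := integrableP _ _ _ iG; apply: le_lt_trans.
  apply: ae_ge0_le_integral => //.
  - by move=> xi _; rewrite lee_fin sqr_ge0.
  - apply/measurable_EFinP; apply: measurable_funX; apply: measurable_funM => //.
    exact: measurable_funD.
  - exact: measurableT_comp.
  - apply: filterS2 WG (uW t t0) => xi h -> _.
    by rewrite lee_fin (le_trans (h t tT))// ler_norm.
apply: cvg_within_halfline.
have Wcvg : {ae mu, forall xi, (fun s => (1 + lam xi) * W s xi)
    @ within [set s | 0 <= s <= t + 1] (nbhs t) --> (1 + lam xi) * W t xi}.
  apply: filterS Wc => xi /(_ t t0) h; apply: cvgM; first exact: cvg_cst.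
  apply: cvg_trans h; apply: cvg_app.
  by apply: within_subset => s /= /andP[s0 _]; rewrite in_itv/= s0.
have := square_dominated_cvg mlW (mlW t) iG _ WG Wcvg.
have WtG : {ae mu, forall xi, ((1 + lam xi) * W t xi) ^+ 2 <= G xi}.
  by apply: filterS WG => xi; apply.
move=> /(_ WtG) h.
(* Dominated convergence controls the squared norm; continuity of the square root at 0 passes to the
   norm. *)
have : Num.sqrt (fine (\int[mu]_xi (((1 + lam xi) * W s xi
    - (1 + lam xi) * W t xi) ^+ 2)%:E)%E)
    @[s --> within [set s | 0 <= s <= t + 1] (nbhs t)] --> (0 : R).
  rewrite -[X in _ --> X]sqrtr0; apply: continuous_cvg => //.
  exact: sqrt_continuous.
move=> /cvgrPdist_lt {}h; apply/cvgrPdist_lt => e /h.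
rewrite !near_withinE; apply: filterS => s {}h sT; move: (h sT).
rewrite /Dnorm Dnorm2_half; congr (`|0 - Num.sqrt (fine _)| < e).
apply: ae_eq_integral => //.
- by apply/measurable_EFinP; apply: measurable_funX; exact: measurable_funB.
- apply/measurable_EFinP; apply: measurable_funX; apply: measurable_funM => //.
  exact: measurable_funD.
move: sT => /andP[s0 _].
have := hatB (u s) (u t); apply: filterS3 (uW s s0) (uW t t0) => xi h1 h2 -> _.
by rewrite h1 h2 mulrBr.
Qed.

End SpectralCalculus.

(** * Regularity of the solution and the high-frequency estimate *)

Theorem theorem3p2
  (R : realType) (H : completeNormedModType R) (ip : {dot H for idfun})
  (H_hilbert : inner_product_of_norm ip) (H_separable : separable_space H)
  (D : set H) (A : H -> H)
  (A_self_adjoint : self_adjoint ip D A)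
  (A_nonneg : nonnegative_operator ip D A)
  (d : measure_display) (M : measurableType d)
  (mu : {measure set M -> \bar R}) (lam : M -> R) (hat : H -> {mfun M >-> R})
  (A_spectral : spectral_representation mu lam hat D A)
  (c omega : R -> R) (mu1 mu2 sigma delta : R)
  (mu1_gt0 : 0 < mu1)
  (c_bounds : forall t : R, 0 <= t -> mu1 <= c t <= mu2)
  (omega_modulus : continuity_modulus omega)
  (c_omega : forall a b : R, 0 <= a -> 0 <= b -> `|c a - c b| <= omega `|a - b|)
  (sigma_bounds : 0 <= sigma <= 1 / 2)
  (delta_gt0 : 0 < delta)
  (Lambda_small :
    ((4 * delta ^+ 2 * mu1)%:E >
      Lambda_infty omega sigma ^+ 2
        + (2 * delta)%:E * Lambda_infty omega sigma)%E)
  (u0 u1 : H) (u0_domain : Dpow mu lam hat (1 / 2) u0)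
  (uhat uhat' : R -> {mfun M >-> R})
  (u_solution :
    componentwise_solution mu lam hat delta sigma c u0 u1 uhat uhat') :
  exists u u' : R -> H,
    [/\ represents mu hat u uhat /\ represents mu hat u' uhat',
        C0_Dpow mu lam hat (1 / 2) u,
        C1_with_derivative u u' &
        forall nu : R, 1 <= nu ->
          (forall l : R, nu <= l ->
            4 * delta ^+ 2 * mu1 >=
              (l `^ (1 - 2 * sigma) * omega (1 / l)) ^+ 2
                + 2 * delta * (l `^ (1 - 2 * sigma) * omega (1 / l))) ->
          forall t : R, 0 <= t ->
            `|high mu lam hat nu (u' t)| ^+ 2
              + 2 * mu1 * `|Apow mu lam hat (1 / 2) (high mu lam hat nu (u t))| ^+ 2
            <= 4 * `|high mu lam hat nu u1| ^+ 2
              + 2 * (3 * delta ^+ 2 + mu2)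
                * `|Apow mu lam hat (1 / 2) (high mu lam hat nu u0)| ^+ 2].
Proof.
have [nu0 nu01 cond0] :=
  ex_high_frequency omega_modulus mu1_gt0 delta_gt0 Lambda_small.
(* Up to a constant depending on the time interval, this is the integrable majorant of all
   components. *)
pose data xi := hat u1 xi ^+ 2 + ((1 + lam xi) * hat u0 xi) ^+ 2.
have data_integrable : mu.-integrable setT (EFin \o data).
  rewrite (_ : EFin \o data = ((EFin \o (fun xi => hat u1 xi ^+ 2)%R)
      \+ (EFin \o (fun xi => ((1 + lam xi) * hat u0 xi) ^+ 2)%R))%E)//.
  apply: integrableD => //; last exact: (Dpow_half_integrable A_spectral).
  exact: Lfun2_integrable_sqr (spec_hat_L2 A_spectral u1).
have energy (T : R) : exists2 K : R, 0 <= K &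
    {ae mu, forall xi (t : R), 0 <= t <= T ->
      uhat' t xi ^+ 2 + ((1 + lam xi) * uhat t xi) ^+ 2 <= K * data xi}.
  (* Domination is required for every real [T], while the scalar estimate needs a nonnegative
     one. *)
  have T0 : 0 <= Num.max T 0 by rewrite le_max lexx orbT.
  have [K K0 hK] := ode_solution_estimate mu1_gt0 c_bounds omega_modulus c_omega
    sigma_bounds delta_gt0 nu01 T0 cond0.
  exists K => //; apply: filterS u_solution => xi sol t /andP[t0 tT].
  apply: (hK _ _ _ _ _ (spec_lam_ge0 A_spectral xi) sol).
  by rewrite t0 le_max tT.
have K_integrable (K : R) : mu.-integrable setT (EFin \o (fun xi => K * data xi)).
  rewrite (_ : EFin \o _ = (fun xi => K%:E * (EFin \o data) xi))%E.
    exact: integrableZl.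
  by apply/funext => xi; rewrite /= EFinM.
have dominated_weighted :
    locally_L2_dominated mu (fun t xi => (1 + lam xi) * uhat t xi).
  move=> T; have [K K0 hK] := energy T; exists (fun xi => K * data xi) => //.
  apply: filterS hK => xi h t /h; apply: le_trans.
  by rewrite lerDr sqr_ge0.
have dominated : locally_L2_dominated mu uhat.
  move=> T; have [G iG hG] := dominated_weighted T; exists G => //.
  apply: filterS hG => xi h t /h; apply: le_trans.
  (* The weight [1 + lam] is at least 1, so the weighted majorant also bounds [uhat]. *)
  rewrite exprMn ler_peMl ?sqr_ge0// exprn_ege1// lerDl.
  exact: (spec_lam_ge0 A_spectral).
have dominated' : locally_L2_dominated mu uhat'.
  move=> T; have [K K0 hK] := energy T; exists (fun xi => K * data xi) => //.
  apply: filterS hK => xi h t /h; apply: le_trans.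
  by rewrite lerDl sqr_ge0.
have [u uE] := represents_ex A_spectral dominated.
have [u' uE'] := represents_ex A_spectral dominated'.
have du : {ae mu, forall xi,
    derivative_on_halfline (uhat ^~ xi : R -> R^o) (uhat' ^~ xi)}.
  by apply: filterS u_solution => xi /ode_solution_derivatives[].
have uC0 : C0_Dpow mu lam hat (1 / 2) u.
  apply: (represents_C0_Dpow_half A_spectral uE dominated_weighted).
  by apply: filterS du => xi h t; exact: (@derivative_on_halfline_cvg R R^o _ _ t h).
exists u, u'; split=> //.
  split; first exact: (represents_derivative A_spectral uE uE' dominated' du).
  apply: (represents_continuous A_spectral uE' dominated').
  apply: filterS u_solution => xi /ode_solution_derivatives[_ h _ _] t.
  exact: (@derivative_on_halfline_cvg R R^o _ _ t h).
(* Here [nu] is any admissible frequency, unrelated to [nu0]; the scalar estimate holds on the band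
   [nu <= lam] and is integrated over it. *)
move=> nu nu1 cond t t0.
have mu20 : 0 <= mu2.
  have /andP[h1 h2] := c_bounds _ t0.
  exact: le_trans (ltW mu1_gt0) (le_trans h1 h2).
apply: (high_energy_le A_spectral) => //.
- by rewrite mulr_ge0// ltW.
- by rewrite mulr_ge0// addr_ge0// mulr_ge0// sqr_ge0.
- by have [] := uC0 t t0.
apply: filterS3 u_solution (uE t t0) (uE' t t0) => xi sol -> -> nul.
exact: (high_frequency_estimate c_bounds omega_modulus c_omega
  sigma_bounds delta_gt0 (le_trans nu1 nul) (cond _ nul) sol).
Qed.
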